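(* Let $\Lambda\in\{-1,0,1\}$ and let $I$ be an ideal tetrahedron in $\mathbb Y_\Lambda$ with vertices $y_1,y_2,y_3,y_4$. Then there is a unique isometry $B\in\mathrm{PGL}^+(2,\mathbb C_\Lambda)$ and $\alpha,\beta,\gamma\in\mathbb R$ satisfying $\alpha+\beta+\gamma=0$ such that, as points of $\partial_\infty\mathbb Y_\Lambda$ (i.e. up to real rescaling of matrices), $$B\rhd y_1=\begin{pmatrix}1&0\\0&0\end{pmatrix},\quad B\rhd y_2=\begin{pmatrix}0&0\\0&1\end{pmatrix},\quad B\rhd y_3=\begin{pmatrix}1&1\\1&1\end{pmatrix},\quad B\rhd y_4=\begin{pmatrix}\frac{s_\Lambda(\beta)^2}{s_\Lambda(\alpha)^2}&-\frac{s_\Lambda(\beta)}{s_\Lambda(\alpha)}e^{\ell\gamma}\\-\frac{s_\Lambda(\beta)}{s_\Lambda(\alpha)}e^{-\ell\gamma}&1\end{pmatrix}.$$ For $\Lambda=1$ one can choose $0<|\alpha|,|\beta|,|\gamma|<\pi$.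
   Context: $\mathbb C_\Lambda=\mathbb R[\ell]/(\ell^2+\Lambda)$, with $\overline{x+\ell y}=x-\ell y$, $|z|^2=z\overline z$; $e^{\ell\theta}=c_\Lambda(\theta)+\ell s_\Lambda(\theta)$, so $s_\Lambda=\sinh,\ \theta\mapsto\theta,\ \sin$ for $\Lambda=-1,0,1$. For $y\in\mathrm{Mat}(2,\mathbb C_\Lambda)$ let $y^\dagger$ be the conjugate transpose. $\mathbb Y_\Lambda=\{y\in\mathrm{Mat}(2,\mathbb C_\Lambda):y^\dagger=y,\ \det y>0\}/\mathbb R^\times$ ($\mathrm{AdS}^3$, half-pipe space, $\mathbb H^3$ for $\Lambda=-1,0,1$), with ideal boundary $\partial_\infty\mathbb Y_\Lambda=\{vv^\dagger:v\in\mathbb C_\Lambda^2,\ vv^\dagger\neq0\}/\mathbb R^\times$. $\mathrm{PGL}^+(2,\mathbb C_\Lambda)=\{B\in\mathrm{Mat}(2,\mathbb C_\Lambda):|\det B|^2>0\}/\mathbb C_\Lambda^\times$ acts on both by $B\rhd y=ByB^\dagger$. Geodesics in $\mathbb Y_\Lambda$ are the curves $t\mapsto B\rhd\exp(tY)$ with $Y^\dagger=Y\neq 0$, $\mathrm{tr}Y=0$; they are spacelike if $-\det Y>0$. Geodesic planes are intersections of $\mathbb Y_\Lambda$ with projective planes of the projectivization of $\{y=y^\dagger\}\cong\mathbb R^4$; a plane is spacelike if all its geodesics are spacelike. An ideal tetrahedron in $\mathbb Y_\Lambda$ is a non-degenerate convex geodesic 3-simplex (the set of points of $\mathbb Y_\Lambda$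 represented by a cone $\{\sum_{i=1}^4b_iy_i':b_i\ge0,\sum b_i\neq0\}$ spanned by four linearly independent vectors $y_i'\in\{y=y^\dagger\}$, all of whose elements outside the four vertex rays represent points of $\mathbb Y_\Lambda$) whose vertices $[y_i']$ lie in $\partial_\infty\mathbb Y_\Lambda$ and whose faces lie on spacelike geodesic planes. *)

(* Defs.v *)
From HB Require Import structures.
From mathcomp Require Import all_boot all_order all_algebra ring.
From mathcomp Require Import all_classical all_reals all_analysis.

Set Implicit Arguments.
Unset Strict Implicit.
Unset Printing Implicit Defensive.

Import Order.TTheory GRing.Theory Num.Theory.
Import numFieldNormedType.Exports.

Local Open Scope classical_set_scope.
Local Open Scope ring_scope.

(* [clam Lam] is R[l]/(l^2 + Lam), with [CLam x y] standing for x + l y. *)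
Record clam (R : realType) (Lam : R) : Type := CLam { clre : R; clim : R }.
Arguments CLam {R} Lam clre clim.

Section Ring.
Variables (R : realType) (Lam : R).
Local Notation C := (clam Lam).
Implicit Types z w : C.

Definition clam_pair z : R * R := (clre z, clim z).
Definition pair_clam (p : R * R) : C := CLam Lam p.1 p.2.

Lemma clam_pairK : cancel clam_pair pair_clam. Proof. by case. Qed.

HB.instance Definition _ := Choice.copy C (can_type clam_pairK).

Lemma clamP z w : clre z = clre w -> clim z = clim w -> z = w.
Proof. by case: z w => [a b] [c d] /= -> ->. Qed.

Definition clam_add z w := CLam Lam (clre z + clre w) (clim z + clim w).
Definition clam_opp z := CLam Lam (- clre z) (- clim z).
Definition clam_mul z w :=
  CLam Lam (clre z * clre w - Lam * (clim z * clim w))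
           (clre z * clim w + clim z * clre w).

Lemma clam_addA : associative clam_add.
Proof. by move=> x y z; apply: clamP => /=; ring. Qed.
Lemma clam_addC : commutative clam_add.
Proof. by move=> x y; apply: clamP => /=; ring. Qed.
Lemma clam_add0 : left_id (CLam Lam 0 0) clam_add.
Proof. by move=> x; apply: clamP => /=; ring. Qed.
Lemma clam_addN : left_inverse (CLam Lam 0 0) clam_opp clam_add.
Proof. by move=> x; apply: clamP => /=; ring. Qed.

HB.instance Definition _ :=
  GRing.isZmodule.Build C clam_addA clam_addC clam_add0 clam_addN.

Lemma clam_mulA : associative clam_mul.
Proof. by move=> x y z; apply: clamP => /=; ring. Qed.
Lemma clam_mulC : commutative clam_mul.
Proof. by move=> x y; apply: clamP => /=; ring. Qed.
Lemma clam_mul1 : left_id (CLam Lam 1 0) clam_mul.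
Proof. by move=> x; apply: clamP => /=; ring. Qed.
Lemma clam_mulDl : left_distributive clam_mul clam_add.
Proof. by move=> x y z; apply: clamP => /=; ring. Qed.
Lemma clam_oner_neq0 : CLam Lam 1 0 != 0.
Proof. by apply/eqP => -[] /eqP; rewrite oner_eq0. Qed.

HB.instance Definition _ := GRing.Zmodule_isComNzRing.Build C
  clam_mulA clam_mulC clam_mul1 clam_mulDl clam_oner_neq0.

Definition cl_ofR (r : R) : C := CLam Lam r 0.
Definition ell : C := CLam Lam 0 1.
Definition clconj z : C := CLam Lam (clre z) (- clim z).
Definition normsq z : C := z * clconj z.

(* z lies in R and is positive there *)
Definition cl_pos z : Prop := clim z = 0 /\ 0 < clre z.

Lemma clreD z w : clre (z + w) = clre z + clre w. Proof. by []. Qed.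
Lemma climD z w : clim (z + w) = clim z + clim w. Proof. by []. Qed.
Lemma clreN z : clre (- z) = - clre z. Proof. by []. Qed.
Lemma climN z : clim (- z) = - clim z. Proof. by []. Qed.
Lemma clreM z w : clre (z * w) = clre z * clre w - Lam * (clim z * clim w).
Proof. by []. Qed.
Lemma climM z w : clim (z * w) = clre z * clim w + clim z * clre w.
Proof. by []. Qed.

Lemma normsqE z : normsq z = cl_ofR (clre z ^+ 2 + Lam * clim z ^+ 2).
Proof. by apply: clamP; rewrite ?clreM ?climM /=; ring. Qed.

Lemma ell_sq : ell ^+ 2 = - cl_ofR Lam.
Proof. by rewrite expr2; apply: clamP; rewrite ?clreM ?climM /=; ring. Qed.

Lemma clamE z : z = cl_ofR (clre z) + ell * cl_ofR (clim z).
Proof.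
by apply: clamP; rewrite ?clreD ?climD ?clreM ?climM /=; ring.
Qed.

Lemma cl_ofR_zmod : zmod_morphism cl_ofR.
Proof. by move=> x y; apply: clamP => //=; rewrite ?climN /= ?subr0. Qed.
Lemma cl_ofR_monoid : monoid_morphism cl_ofR.
Proof. by split=> [//|x y]; apply: clamP; rewrite ?clreM ?climM /=; ring. Qed.

HB.instance Definition _ := GRing.isZmodMorphism.Build R C cl_ofR cl_ofR_zmod.
HB.instance Definition _ :=
  GRing.isMonoidMorphism.Build R C cl_ofR cl_ofR_monoid.

Lemma clconj_zmod : zmod_morphism clconj.
Proof. by move=> x y; apply: clamP => //=; ring. Qed.
Lemma clconj_monoid : monoid_morphism clconj.
Proof.
by split=> [|x y]; apply: clamP; rewrite ?clreM ?climM //= ?oppr0 //; ring.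
Qed.

HB.instance Definition _ := GRing.isZmodMorphism.Build C C clconj clconj_zmod.
HB.instance Definition _ :=
  GRing.isMonoidMorphism.Build C C clconj clconj_monoid.

Definition cl_unit : {pred C} := [pred z | clre (normsq z) != 0].
Definition cl_inv z : C :=
  if z \in cl_unit then cl_ofR (clre (normsq z))^-1 * clconj z else z.

Lemma cl_mulVx : {in cl_unit, left_inverse 1 cl_inv *%R}.
Proof.
move=> z zU; rewrite /cl_inv zU -mulrA [clconj z * z]mulrC -/(normsq z).
rewrite [X in _ * X]normsqE -rmorphM -[RHS](rmorph1 cl_ofR); congr cl_ofR.
by move: zU; rewrite inE normsqE /= => zU; rewrite mulVf.
Qed.

Lemma cl_unitPl z w : w * z = 1 -> cl_unit z.
Proof.
move=> wz; apply/negP => /eqP z0.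
have : normsq w * normsq z = 1.
  by rewrite /normsq mulrACA -rmorphM wz rmorph1 mulr1.
rewrite [normsq z]normsqE; move: z0; rewrite normsqE /= => ->.
by rewrite (rmorph0 cl_ofR) mulr0 => /esym/eqP; rewrite oner_eq0.
Qed.

Lemma cl_invr_out : {in [predC cl_unit], cl_inv =1 id}.
Proof. by move=> z /negPf zU; rewrite /cl_inv zU. Qed.

HB.instance Definition _ :=
  GRing.ComNzRing_hasMulInverse.Build C cl_mulVx cl_unitPl cl_invr_out.

Lemma cl_unitE z : (z \is a GRing.unit) = (clre (normsq z) != 0).
Proof. by []. Qed.

End Ring.

Arguments cl_ofR {R Lam} r.
Arguments ell {R Lam}.
Notation "r %:CL" := (cl_ofR r) (at level 1, format "r %:CL") : ring_scope.

Section Exponential.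
Variables (R : realType) (Lam : R).
Local Notation C := (clam Lam).

(* Limits in C ~ R^2 and in 'M[C]_2 are taken coordinatewise. *)
Definition cl_lim (u : nat -> C) : C :=
  CLam Lam (lim ((fun n => clre (u n)) @ \oo)) (lim ((fun n => clim (u n)) @ \oo)).

Definition cl_exp (z : C) : C :=
  cl_lim (series (fun k => (k`!%:R^-1)%:CL * z ^+ k)).

Definition mx_exp (Y : 'M[C]_2) : 'M[C]_2 :=
  \matrix_(i, j)
    cl_lim (fun n => series (fun k => (k`!%:R^-1)%:CL *: Y ^+ k) n i j).

Definition exp_ell (t : R) : C := cl_exp (ell * t%:CL).
Definition cLam (t : R) : R := clre (exp_ell t).
Definition sLam (t : R) : R := clim (exp_ell t).

End Exponential.

Arguments exp_ell {R} Lam t.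
Arguments cLam {R} Lam t.
Arguments sLam {R} Lam t.

Section ExponentialFacts.
Variable R : realType.
Implicit Types Lam t : R.

Lemma clre_series Lam (u : nat -> clam Lam) n :
  clre (series u n) = series (fun k => clre (u k)) n.
Proof.
rewrite /series /=; elim: n => [|n IHn]; first by rewrite !big_geq.
by rewrite !big_nat_recr //= IHn.
Qed.

Lemma clim_series Lam (u : nat -> clam Lam) n :
  clim (series u n) = series (fun k => clim (u k)) n.
Proof.
rewrite /series /=; elim: n => [|n IHn]; first by rewrite !big_geq.
by rewrite !big_nat_recr //= IHn.
Qed.

Lemma exp_ell_term Lam t k :
  (k`!%:R^-1)%:CL * (ell * t%:CL) ^+ k =
  CLam Lam ((~~ odd k)%:R * (- Lam) ^+ k./2 * t ^+ k / k`!%:R)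
           ((odd k)%:R * (- Lam) ^+ k./2 * t ^+ k / k`!%:R).
Proof.
have -> : (ell * t%:CL) ^+ k =
    CLam Lam ((~~ odd k)%:R * (- Lam) ^+ k./2 * t ^+ k)
             ((odd k)%:R * (- Lam) ^+ k./2 * t ^+ k).
  rewrite exprMn -rmorphXn /= -{1}(odd_double_half k) exprD -mul2n exprM.
  rewrite ell_sq -rmorphN -rmorphXn /=.
  by case: (odd k); rewrite ?expr1 ?expr0; apply: clamP;
    rewrite ?clreM ?climM /=; ring.
by apply: clamP; rewrite ?clreM ?climM /=; ring.
Qed.

Lemma cLamE Lam t : cLam Lam t =
  lim (series (fun k => (~~ odd k)%:R * (- Lam) ^+ k./2 * t ^+ k / k`!%:R) @ \oo).
Proof.
rewrite /cLam /exp_ell /cl_exp /=; congr (lim (_ @ \oo)); apply/funext => n.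
by rewrite clre_series; congr (series _ n); apply/funext => k; rewrite exp_ell_term.
Qed.

Lemma sLamE Lam t : sLam Lam t =
  lim (series (fun k => (odd k)%:R * (- Lam) ^+ k./2 * t ^+ k / k`!%:R) @ \oo).
Proof.
rewrite /sLam /exp_ell /cl_exp /=; congr (lim (_ @ \oo)); apply/funext => n.
by rewrite clim_series; congr (series _ n); apply/funext => k; rewrite exp_ell_term.
Qed.

Lemma sLam1 t : sLam 1 t = sin t.
Proof.
rewrite sLamE unlock; congr (lim (series _ @ \oo)); apply/funext => k.
rewrite /sin_coeff /=; case/boolP: (odd k) => [ko|]; last by rewrite !mul0r.
by case: k ko => //= k /negPf ko; rewrite uphalf_half ko.
Qed.

Lemma cLam1 t : cLam 1 t = cos t.
Proof. by rewrite cLamE unlock; congr (lim (series _ @ \oo)). Qed.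

Lemma series_2terms (u : nat -> R) :
  (forall k, u k.+2 = 0) -> lim (series u @ \oo) = u 0%N + u 1%N.
Proof.
move=> u0; apply/cvg_lim => //; rewrite -(cvg_shiftn 2) /=.
rewrite [X in X @ \oo --> _](_ : _ = fun=> u 0%N + u 1%N); first exact: cvg_cst.
apply/funext => n; rewrite addn2 /series /=.
by rewrite big_nat_recl // big_nat_recl //= big1 // addr0.
Qed.

Lemma sLam0 t : sLam 0 t = t.
Proof.
rewrite sLamE series_2terms => [|k]; last first.
  by rewrite /= oppr0 expr0n mulr0 !mul0r.
by rewrite /= !fact0 !mul0r add0r expr0 !mul1r invr1 mulr1.
Qed.

Lemma cLam0 t : cLam 0 t = 1.
Proof.
rewrite cLamE series_2terms => [|k]; last first.
  by rewrite /= oppr0 expr0n mulr0 !mul0r.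
by rewrite /= !mul0r addr0 !expr0 !mul1r fact0 invr1.
Qed.

Lemma sLamN1 t : sLam (- 1) t = (expR t - expR (- t)) / 2.
Proof.
rewrite sLamE; apply/cvg_lim => //.
have -> : (fun k => (odd k)%:R * (- -1) ^+ k./2 * t ^+ k / k`!%:R) =
    2^-1 *: (exp_coeff t - exp_coeff (- t)).
  apply/funext => k; rewrite -[RHS]/(2^-1 * (t ^+ k / k`!%:R - (- t) ^+ k / k`!%:R)).
  rewrite opprK expr1n exprNn -signr_odd; move: (t ^+ k) (_ ^-1) => a b.
  by case: (odd k); rewrite ?expr1 ?expr0 /=; field.
rewrite mulrC seriesZ seriesD seriesN; apply: cvgZr.
by apply: cvgB; exact: is_cvg_series_exp_coeff.
Qed.

Lemma cLamN1 t : cLam (- 1) t = (expR t + expR (- t)) / 2.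
Proof.
rewrite cLamE; apply/cvg_lim => //.
have -> : (fun k => (~~ odd k)%:R * (- -1) ^+ k./2 * t ^+ k / k`!%:R) =
    2^-1 *: (exp_coeff t + exp_coeff (- t)).
  apply/funext => k; rewrite -[RHS]/(2^-1 * (t ^+ k / k`!%:R + (- t) ^+ k / k`!%:R)).
  rewrite opprK expr1n exprNn -signr_odd; move: (t ^+ k) (_ ^-1) => a b.
  by case: (odd k); rewrite ?expr1 ?expr0 /=; field.
rewrite mulrC seriesZ seriesD; apply: cvgZr.
by apply: cvgD; exact: is_cvg_series_exp_coeff.
Qed.

End ExponentialFacts.

Section Geometry.
Variables (R : realType) (Lam : R).
Local Notation C := (clam Lam).
Local Notation M := 'M[C]_2.

Definition ctr m n (A : 'M[C]_(m, n)) : 'M[C]_(n, m) := map_mx (@clconj R Lam) A^T.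
Definition hermitian (y : M) : Prop := ctr y = y.

(* Quotients by R^x and by C_Lam^x are sets of equivalence classes: a point of
   the real projective space of matrices is the set of all its representatives,
   and so is an element of PGL^+. *)
Definition ppoint : Type := set M.
Definition proj (y : M) : ppoint := [set r%:CL *: y | r in [set r : R | r != 0]].

Definition pgl : Type := set M.
Definition pgl_class (B : M) : pgl :=
  [set z *: B | z in [set z : C | z \is a GRing.unit]].
Definition PGLplus : set pgl :=
  [set pgl_class B | B in [set B : M | cl_pos (normsq (\det B))]].

Definition act (B : pgl) (y : ppoint) : ppoint :=
  [set b *m x *m ctr b | b in B & x in y].

Definition YLam : set ppoint :=
  [set proj y | y in [set y : M | hermitian y /\ cl_pos (\det y)]].
Definition bdYLam : set ppoint :=
  [set proj (v *m ctr v) | v in [set v : 'cV[C]_2 | v *m ctr v != 0]].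

Definition geodesic (B : pgl) (Y : M) (t : R) : ppoint :=
  act B (proj (mx_exp (t%:CL *: Y))).

Definition rcomb n (u : 'I_n -> M) (b : 'I_n -> R) : M := \sum_i (b i)%:CL *: u i.

Definition rfree n (u : 'I_n -> M) : Prop :=
  forall b, rcomb u b = 0 -> forall i, b i = 0.

Definition geodesic_plane (P : set ppoint) : Prop :=
  exists u : 'I_3 -> M, [/\ forall i, hermitian (u i), rfree u &
    P = YLam `&` [set proj w | w in range (rcomb u)]].

Definition spacelike_plane (P : set ppoint) : Prop :=
  forall (B : pgl) (Y : M), PGLplus B -> hermitian Y -> Y != 0 -> \tr Y = 0 ->
    (forall t, P (geodesic B Y t)) -> cl_pos (- \det Y).

Definition cone (u : 'I_4 -> M) : set M :=
  [set rcomb u b | b in [set b | (forall i, 0 <= b i) /\ \sum_i b i != 0]].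

Definition vertex_ray (u : 'I_4 -> M) (i : 'I_4) : set M :=
  [set c%:CL *: u i | c in [set c : R | 0 < c]].

Definition cone_face (u : 'I_4 -> M) (i : 'I_4) : set M :=
  [set rcomb u b | b in
    [set b | [/\ forall j, 0 <= b j, \sum_j b j != 0 & b i = 0]]].

Definition points_of (K : set M) : set ppoint := YLam `&` [set proj w | w in K].

(* [I] is an ideal tetrahedron with vertices [y 0], ..., [y 3] *)
Definition ideal_tetrahedron (I : set ppoint) (y : 'I_4 -> ppoint) : Prop :=
  exists u : 'I_4 -> M,
  [/\ (forall i, hermitian (u i)) /\ rfree u,
      forall w, cone u w -> (forall i, ~ vertex_ray u i w) -> YLam (proj w),
      I = points_of (cone u),
      forall i, y i = proj (u i) /\ bdYLam (y i) &
      forall i, exists P, [/\ geodesic_plane P, spacelike_plane P &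
        points_of (cone_face u i) `<=` P]].

Definition mx2 (a b c d : C) : M :=
  \matrix_(i, j) if i == 0 then (if j == 0 then a else b)
                 else (if j == 0 then c else d).

(* [B] and the parameters satisfy the four equations; [sLam Lam a != 0] makes
   the quotients meaningful. *)
Definition normalizes (y1 y2 y3 y4 : ppoint) (B : pgl) (a b c : R) : Prop :=
  let r := sLam Lam b / sLam Lam a in
  [/\ PGLplus B, a + b + c = 0, sLam Lam a != 0 &
  [/\ act B y1 = proj (mx2 1 0 0 0),
      act B y2 = proj (mx2 0 0 0 1),
      act B y3 = proj (mx2 1 1 1 1) &
      act B y4 = proj (mx2 (sLam Lam b ^+ 2 / sLam Lam a ^+ 2)%:CL
                           (- (r%:CL * exp_ell Lam c))
                           (- (r%:CL * exp_ell Lam (- c))) 1)]].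

Lemma projP (y y' : M) : proj y = proj y' <-> exists2 r : R, r != 0 & y' = r%:CL *: y.
Proof.
split=> [e|[r r0 ->]].
  have : proj y y' by rewrite e; exists 1; rewrite ?rmorph1 ?scale1r //= oner_neq0.
  by case=> r r0 <-; exists r.
apply/seteqP; split=> _ [s /= s0 <-].
  exists (s / r); first by apply: mulf_neq0; rewrite ?invr_eq0.
  by rewrite scalerA -rmorphM /= divfK.
exists (s * r); first exact: mulf_neq0.
by rewrite scalerA rmorphM.
Qed.

Lemma ctrZ m n (z : C) (A : 'M[C]_(m, n)) : ctr (z *: A) = clconj z *: ctr A.
Proof. by apply/matrixP => i j; rewrite !mxE rmorphM. Qed.

Lemma act_proj (B y : M) : act (pgl_class B) (proj y) = proj (B *m y *m ctr B).
Proof.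
apply/seteqP; split=> [_ [_ [z /= zU <-] [_ [r /= r0 <-] <-]]|_ [r /= r0 <-]].
  exists (clre (normsq z) * r); first by apply: mulf_neq0 => //; rewrite -cl_unitE.
  rewrite ctrZ -!scalemxAl -!scalemxAr -!scalemxAl !scalerA; congr (_ *: _).
  have -> : (clre (normsq z) * r)%:CL = r%:CL * normsq z.
    have nE : normsq z = (clre (normsq z))%:CL by rewrite normsqE.
    by rewrite rmorphM /= mulrC -nE.
  by rewrite /normsq; ring.
exists B; first by exists 1; rewrite ?scale1r //= unitr1.
exists (r%:CL *: y); first by exists r.
by rewrite -scalemxAr -scalemxAl.
Qed.

End Geometry.

(* Main.v *)
(* A vertex is a real multiple of v v^dagger, and
   det(r v v^dagger + s w w^dagger) = r s |det(v, w)|^2.  Since each edge meets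
   the interior of Y_Lam, and v may be traded for l v to change the sign of r
   when Lam = -1, we get |[ij]|^2 > 0 for the brackets [ij] = det(v_i, v_j).
   Hence the matrix sending v1, v2, v3 to multiples of (1,0), (0,1), (1,1) lies
   in PGL^+ and sends v4 to a multiple of (z, 1) with
   z = [13][42] / ([32][14]); by Pluecker, |z - 1|^2 > 0 too.  If z were real the
   four rank-one matrices would be dependent.  Solving
   z = - s(b)/s(a) e^{l c} with b = - a - c amounts to the polar form of -z
   (and of |z| + e^{l c}) for Lam = 1, and to a linear problem in the null
   coordinates x +- y for Lam = -1.  Uniqueness holds because a matrix fixing the
   three points (1,0), (0,1), (1,1) is scalar. *)
Require Import Defs.
From mathcomp Require Import all_boot all_order all_algebra.
From mathcomp Require Import ring lra.
From mathcomp Require Import all_classical all_reals all_analysis.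

Set Implicit Arguments.
Unset Strict Implicit.
Unset Printing Implicit Defensive.

Import Order.TTheory GRing.Theory Num.Theory.

Local Open Scope classical_set_scope.
Local Open Scope ring_scope.

(* [proj] alone would denote the product projections of mathcomp-analysis *)
Local Notation proj := Defs.proj.

(** * The norm form of the algebra, as a real number *)

Section Norm.
Variables (R : realType) (Lam : R).
Implicit Types z w : clam Lam.

(** This form is indefinite when [Lam = -1] and degenerate when [Lam = 0], so its positivity has to
    be tracked. *)
Definition nrm z : R := clre (normsq z).

Lemma nrmE z : nrm z = clre z ^+ 2 + Lam * clim z ^+ 2.
Proof. by rewrite /nrm normsqE. Qed.

Lemma normsq_nrm z : normsq z = (nrm z)%:CL.
Proof. by rewrite normsqE nrmE. Qed.

Lemma nrmM z w : nrm (z * w) = nrm z * nrm w.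
Proof. by rewrite !nrmE clreM climM; ring. Qed.

Lemma nrm_ge0 z : 0 <= Lam -> 0 <= nrm z.
Proof. by move=> L0; rewrite nrmE addr_ge0 ?sqr_ge0 // mulr_ge0 ?sqr_ge0. Qed.

Lemma cl_pos_normsq z : cl_pos (normsq z) <-> 0 < nrm z.
Proof. by rewrite normsq_nrm; split=> [[]|]. Qed.

Lemma nrm_gt0_unit z : 0 < nrm z -> z \is a GRing.unit.
Proof. by move=> z0; rewrite cl_unitE -/(nrm z) gt_eqF. Qed.

Lemma clconjK z : clconj (clconj z) = z.
Proof. by case: z => x y; rewrite /clconj /= opprK. Qed.

Lemma clconj_ofRM (x : R) z : clconj (x%:CL * z) = x%:CL * clconj z.
Proof. by apply: clamP; rewrite ?clreM ?climM /= ?clreM ?climM /=; ring. Qed.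

End Norm.

(** * Parity and unit norm of the exponential *)

Section Exp.
Variables (R : realType) (Lam : R).
Hypothesis LamP : [\/ Lam = -1, Lam = 0 | Lam = 1].

Lemma exp_ellE t : exp_ell Lam t = CLam Lam (cLam Lam t) (sLam Lam t).
Proof. exact: clamP. Qed.

Lemma cLamN t : cLam Lam (- t) = cLam Lam t.
Proof.
by case: LamP => ->; rewrite ?cLamN1 ?cLam0 ?cLam1 ?cosN // opprK addrC.
Qed.

Lemma sLamN t : sLam Lam (- t) = - sLam Lam t.
Proof.
case: LamP => ->; rewrite ?sLamN1 ?sLam0 ?sLam1 ?sinN // opprK.
by rewrite -mulNr opprB.
Qed.

Lemma exp_ellN t : exp_ell Lam (- t) = clconj (exp_ell Lam t).
Proof. by rewrite !exp_ellE cLamN sLamN. Qed.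

Lemma nrm_exp_ell t : nrm (exp_ell Lam t) = 1.
Proof.
rewrite nrmE exp_ellE /=; case: LamP => ->.
- rewrite cLamN1 sLamN1.
  have e1 : expR t * expR (- t) = 1 by rewrite -expRD subrr expR0.
  by rewrite -[RHS]e1; field.
- by rewrite cLam0; ring.
- by rewrite cLam1 sLam1 mul1r cos2Dsin2.
Qed.

End Exp.

(** * Existence of the angles for a given shape parameter *)

Section Angles.
Variable R : realType.
Implicit Types p q x y : R.

(** Polar coordinates in the open upper half-plane: [q > 0] gives [|p / m| < 1], so the arccosine of
    [p / m] lies strictly between 0 and pi. *)
Lemma polar_upper p q : 0 < q ->
  exists m t : R, [/\ 0 < m, 0 < t < pi, p = m * cos t & q = m * sin t].
Proof.
move=> q0; set m := Num.sqrt (p ^+ 2 + q ^+ 2).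
have s0 : 0 < p ^+ 2 + q ^+ 2 by rewrite ltr_wpDl ?sqr_ge0 // exprn_gt0.
have m0 : 0 < m by rewrite sqrtr_gt0.
have m2 : m ^+ 2 = p ^+ 2 + q ^+ 2 by rewrite sqr_sqrtr // ltW.
have ltpm : `|p / m| < 1.
  rewrite normrM normfV (gtr0_norm m0) ltr_pdivrMr // mul1r.
  rewrite -ltr_sqr ?nnegrE ?normr_ge0 ?(ltW m0) // m2.
  by rewrite real_normK ?num_real // ltrDl exprn_gt0.
move: ltpm; rewrite ltr_norml => /andP[l1 l2].
exists m, (acos (p / m)); split=> //.
- by rewrite acos_gt0 ?acos_ltpi // ?l1 ?l2 ?(ltW l1) ?(ltW l2).
- by rewrite acosK ?in_itv /= ?(ltW l1) ?(ltW l2) // mulrC divfK ?gt_eqF.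
- rewrite sin_acos ?(ltW l1) ?(ltW l2) //.
  have -> : 1 - (p / m) ^+ 2 = (q / m) ^+ 2.
    rewrite !expr_div_n m2; field.
    by rewrite gt_eqF.
  by rewrite sqrtr_sqr ger0_norm ?divr_ge0 ?ltW // mulrC divfK ?gt_eqF.
Qed.

(** Write [-z = m e^{ic}] and let [t] be the argument of [m + e^{ic}]. Then [(m + e^{ic}) e^{-it}]
    is real, and its vanishing imaginary part reads [sin (t - c) = - m sin t]. The angles [-t],
    [t - c], [c] sum to zero and have sine ratio [m]. *)
Lemma angles_sphere_lower x y : y < 0 ->
  exists a b c : R, [/\ a + b + c = 0, sin a != 0,
    [/\ 0 < `|a| < pi, 0 < `|b| < pi & 0 < `|c| < pi],
    x = - (sin b / sin a * cos c) & y = - (sin b / sin a * sin c)].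
Proof.
move=> y0; have [|m [c [m0 c0 xE yE]]] := @polar_upper (- x) (- y).
  by rewrite oppr_gt0.
have sc0 : 0 < sin c by apply: sin_gt0_pi.
have [n [a [n0 a0 cE sE]]] := polar_upper (m + cos c) sc0.
have sa0 : 0 < sin a by apply: sin_gt0_pi.
have sb : sin (a - c) = - (m * sin a).
  apply: (mulfI (lt0r_neq0 n0)); rewrite sinB mulrBr !mulrA -sE -cE.
  by rewrite mulrN mulrA [n * m]mulrC -mulrA -sE; ring.
have b0 : a - c != 0.
  apply/eqP => e; move: sb; rewrite e sin0 => /esym/eqP.
  by rewrite oppr_eq0 mulf_eq0 !gt_eqF.
have r : sin (a - c) / sin (- a) = m.
  by rewrite sb sinN; field; rewrite gt_eqF.
exists (- a), (a - c), c; split; rewrite ?r.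
- by ring.
- by rewrite sinN oppr_eq0 gt_eqF.
- case/andP: a0 => a0 a1; case/andP: c0 => c0 c1.
  rewrite normrN (gtr0_norm a0) (gtr0_norm c0) a0 a1 c0 c1 normr_gt0 b0 ltr_norml.
  split=> //=.
  by apply/andP; split; lra.
- by rewrite -xE opprK.
- by rewrite -yE opprK.
Qed.

Lemma angles_sphere x y : y != 0 ->
  exists a b c : R, [/\ a + b + c = 0, sin a != 0,
    [/\ 0 < `|a| < pi, 0 < `|b| < pi & 0 < `|c| < pi],
    x = - (sin b / sin a * cos c) & y = - (sin b / sin a * sin c)].
Proof.
rewrite neq_lt => /orP[|y0]; first exact: angles_sphere_lower.
(* Conjugation: negating all three angles keeps the sine ratio and [cos c] and flips the sign of
   [sin c]. *)
have [|a [b [c [s0 sa h xE yE]]]] := @angles_sphere_lower x (- y).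
  by rewrite oppr_lt0.
exists (- a), (- b), (- c); split; rewrite ?normrN ?sinN ?cosN ?oppr_eq0 //.
- by rewrite -!opprD s0 oppr0.
- by rewrite invrN mulrNN.
- by rewrite invrN mulrNN mulrN opprK -[LHS]opprK yE opprK.
Qed.

(** The null coordinates [p = x + y] and [q = x - y] turn the two equations into [p = - r e^c] and
    [q = - r e^{-c}], where [r = s b / s a]. Their quotient gives [e^{2c}], and the first equation
    is then linear in [e^{2a}]. *)
Lemma angles_hyperbolic x y :
    0 < x ^+ 2 - y ^+ 2 -> 0 < (x - 1) ^+ 2 - y ^+ 2 -> y != 0 ->
  let s := sLam (- 1) : R -> R in
  exists a b c : R, [/\ a + b + c = 0, s a != 0,
    x = - (s b / s a * cLam (- 1) c) & y = - (s b / s a * s c)].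
Proof.
set p := x + y; set q := x - y => h1 h2 y0 s.
have pq : 0 < p * q by rewrite (_ : p * q = x ^+ 2 - y ^+ 2) // /p /q; ring.
have pq1 : 0 < (1 - p) * (1 - q).
  by rewrite (_ : _ * _ = (x - 1) ^+ 2 - y ^+ 2) // /p /q; ring.
have [p0 q0] : p != 0 /\ q != 0.
  by apply/andP; rewrite -negb_or -mulf_eq0 gt_eqF.
have [p1 q1] : 1 - p != 0 /\ 1 - q != 0.
  by apply/andP; rewrite -negb_or -mulf_eq0 gt_eqF.
(* The values sought for [e^{2a}] and [e^{2c}]. The norm hypotheses make them positive, and [y != 0]
   gives [E2 != 1], that is [s a != 0]. *)
pose E2 := q * (1 - p) / (p * (1 - q)); pose G2 := p / q.
have E2gt0 : 0 < E2.
  rewrite (_ : E2 = p * q * ((1 - p) * (1 - q)) / (p * (1 - q)) ^+ 2).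
    apply: divr_gt0; first exact: mulr_gt0.
    by rewrite exprn_even_gt0 //= mulf_neq0.
  by rewrite /E2; field; rewrite p0 q1.
have G2gt0 : 0 < G2.
  rewrite (_ : G2 = p * q / q ^+ 2); last by rewrite /G2; field.
  by rewrite divr_gt0 // exprn_even_gt0.
have sq_exp (z : R) : 0 < z -> expR (ln z / 2) ^+ 2 = z.
  by move=> z0; rewrite -expRM_natr divfK ?pnatr_eq0 // lnK.
pose a := ln E2 / 2; pose c := ln G2 / 2.
have := sq_exp _ E2gt0; have := sq_exp _ G2gt0; rewrite -/a -/c.
have := expR_gt0 a; have := expR_gt0 c.
move Ea : (expR a) => E; move Gc : (expR c) => G => G0 E0 GG EE.
have E21 : E ^+ 2 - 1 != 0.
  rewrite EE (_ : E2 - 1 = - 2 * y / (p * (1 - q))).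
    by rewrite !mulf_neq0 ?invr_eq0 ?mulf_neq0 // oppr_eq0 pnatr_eq0.
  by rewrite /E2 /p /q; field; rewrite p0 q1.
have sa : s a = (E ^+ 2 - 1) / (2 * E).
  by rewrite /s sLamN1 expRN Ea; field; rewrite gt_eqF.
have sc : s c = (G ^+ 2 - 1) / (2 * G).
  by rewrite /s sLamN1 expRN Gc; field; rewrite gt_eqF.
have cc : cLam (- 1) c = (G ^+ 2 + 1) / (2 * G).
  by rewrite cLamN1 expRN Gc; field; rewrite gt_eqF.
have sb : s (- (a + c)) = (1 - E ^+ 2 * G ^+ 2) / (2 * E * G).
  by rewrite /s sLamN1 opprK expRN expRD Ea Gc; field; rewrite !gt_eqF.
have r : s (- (a + c)) / s a = (1 - E2 * G2) / (E2 - 1) / G.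
  by rewrite sb sa -EE -GG; field; rewrite E21 !gt_eqF.
have rE : (1 - E2 * G2) / (E2 - 1) = - p.
  rewrite EE in E21.
  have : (1 - E2 * G2) = - p * (E2 - 1).
    by rewrite /E2 /G2; field; rewrite p0 q0 q1.
  by move=> ->; rewrite mulfK.
exists a, (- (a + c)), c; split.
- by ring.
- by rewrite sa mulf_neq0 // invr_eq0 mulf_neq0 ?pnatr_eq0 // gt_eqF.
(* Here [x = (p + q) / 2] with [q = p / G ^+ 2]; likewise [y = (p - q) / 2] below. *)
- rewrite r rE cc (_ : - _ = p * (1 + (G ^+ 2)^-1) / 2).
    by rewrite GG /G2 /p /q; field; rewrite p0 q0.
  by field; rewrite gt_eqF.
- rewrite r rE sc (_ : - _ = p * (1 - (G ^+ 2)^-1) / 2).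
    by rewrite GG /G2 /p /q; field; rewrite p0 q0.
  by field; rewrite gt_eqF.
Qed.

End Angles.

Lemma exists_angles (R : realType) (Lam : R) (z : clam Lam) :
    [\/ Lam = -1, Lam = 0 | Lam = 1] ->
    0 < nrm z -> 0 < nrm (z - 1) -> clim z != 0 ->
  exists a b c : R, [/\ a + b + c = 0, sLam Lam a != 0,
    Lam = 1 -> [/\ 0 < `|a| < pi, 0 < `|b| < pi & 0 < `|c| < pi] &
    z = - ((sLam Lam b / sLam Lam a)%:CL * exp_ell Lam c)].
Proof.
rewrite !nrmE /= oppr0 addr0; case: z => x y /=.
have zE L (r c : R) : x = - (r * cLam L c) -> y = - (r * sLam L c) ->
    CLam L x y = - (r%:CL * exp_ell L c).
  move=> -> ->; rewrite exp_ellE.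
  by apply: clamP; rewrite ?clreN ?climN ?clreM ?climM /=; ring.
case=> LamE; rewrite LamE in zE *; rewrite ?mulN1r ?mul0r ?mul1r ?addr0.
- move=> h1 h2 y0; have [a [b [c [s0 sa xE yE]]]] := angles_hyperbolic h1 h2 y0.
  exists a, b, c; split=> //; last exact: zE.
  by move=> e; have := @ltr01 R; rewrite -e ltr0N1.
- move=> x0 x1 y0.
  have {}x0 : x != 0 by apply: contraTneq x0 => ->; rewrite expr0n ltxx.
  have {}x1 : x - 1 != 0 by apply: contraTneq x1 => ->; rewrite expr0n ltxx.
  (* For [Lam = 0] the equation splits into [- b / a = x] and [x * c = y]; together with
     [a + b + c = 0] these determine the angles. *)
  exists (y / x / (x - 1)), (- y / (x - 1)), (y / x).
  rewrite !sLam0; split; first by field; rewrite x0 x1.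
  + by rewrite !mulf_neq0 ?invr_eq0.
  + by move=> /esym/eqP; rewrite oner_eq0.
  + by apply: zE; rewrite ?cLam0 ?sLam0; field; rewrite x0 x1 y0.
- move=> _ _ y0; have [a [b [c [s0 sa h xE yE]]]] := angles_sphere x y0.
  exists a, b, c; split; rewrite ?sLam1 //.
  by apply: zE; rewrite ?cLam1 ?sLam1.
Qed.

(** * Rank-one hermitian matrices, brackets and projective frames *)

Section Hermitian.
Variables (R : realType) (Lam : R).
Local Notation C := (clam Lam).
Local Notation M := 'M[C]_2.
Implicit Types (v w : 'cV[C]_2) (u y B : M) (z : C).

Definition br v w : C := v 0 0 * w 1 0 - v 1 0 * w 0 0.
Definition rank1 v : M := v *m ctr v.
Definition cv2 (a b : C) : 'cV[C]_2 := \col_i (if i == 0 then a else b).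

Lemma ord2P (P : 'I_2 -> Prop) : P 0 -> P 1 -> forall i, P i.
Proof.
move=> P0 P1 [[|[|//]] i]; first by rewrite (_ : Ordinal i = 0) //; exact: val_inj.
by rewrite (_ : Ordinal i = 1) //; exact: val_inj.
Qed.

Lemma mx22P u y : u 0 0 = y 0 0 -> u 0 1 = y 0 1 -> u 1 0 = y 1 0 ->
  u 1 1 = y 1 1 -> u = y.
Proof. by move=> h1 h2 h3 h4; apply/matrixP; apply: ord2P; apply: ord2P. Qed.

Lemma sum_ord2 (F : 'I_2 -> C) : \sum_i F i = F 0 + F 1.
Proof. by rewrite !big_ord_recl big_ord0 addr0; congr (_ + F _); apply: val_inj. Qed.

Lemma det_mx22 y : \det y = y 0 0 * y 1 1 - y 0 1 * y 1 0.
Proof.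
rewrite (expand_det_row _ 0) sum_ord2 /cofactor !det_mx11 !mxE /=.
rewrite expr0 expr1 mul1r mulN1r mulrN.
by congr (_ * y _ _ - _ * y _ _); apply: val_inj.
Qed.

Lemma rank1E v i j : rank1 v i j = v i 0 * clconj (v j 0).
Proof. by rewrite mxE big_ord_recl big_ord0 addr0 !mxE. Qed.

Lemma rank1_cv2 (a b : C) :
  rank1 (cv2 a b) = mx2 (normsq a) (a * clconj b) (b * clconj a) (normsq b).
Proof. by apply: mx22P; rewrite rank1E !mxE. Qed.

Lemma rank1Z z v : rank1 (z *: v) = (nrm z)%:CL *: rank1 v.
Proof.
by rewrite /rank1 ctrZ -scalemxAl -scalemxAr scalerA -normsq_nrm.
Qed.

Lemma ctrM m n p (A : 'M[C]_(m, n)) (D : 'M[C]_(n, p)) :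
  ctr (A *m D) = ctr D *m ctr A.
Proof. by rewrite /ctr trmx_mul map_mxM. Qed.

Lemma conj_rank1 B v : B *m rank1 v *m ctr B = rank1 (B *m v).
Proof. by rewrite /rank1 ctrM !mulmxA. Qed.

Lemma det_rank1D (r s : R) v w :
  \det (r%:CL *: rank1 v + s%:CL *: rank1 w) = (r * s * nrm (br v w))%:CL.
Proof.
have E i j : (r%:CL *: rank1 v + s%:CL *: rank1 w) i j =
    r%:CL * (v i 0 * clconj (v j 0)) + s%:CL * (w i 0 * clconj (w j 0)).
  by rewrite mxE [X in X + _]mxE [X in _ + X]mxE !rank1E.
have -> : (r * s * nrm (br v w))%:CL = r%:CL * s%:CL * normsq (br v w).
  by rewrite normsq_nrm -!rmorphM.
by rewrite det_mx22 !E /normsq /br rmorphB !rmorphM /=; ring.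
Qed.

Lemma projZ (r : R) y : r != 0 -> proj (r%:CL *: y) = proj y.
Proof. by move=> r0; apply/esym/projP; exists r. Qed.

Lemma YLam_proj y : YLam (proj y) -> 0 < clre (\det y).
Proof.
case=> h [_ [d0 d]] /projP[r r0 ->].
have -> : \det (r%:CL *: h) = (r ^+ 2)%:CL * \det h.
  by rewrite detZ rmorphXn.
by rewrite clreM /= mul0r mulr0 subr0 mulr_gt0 // exprn_even_gt0.
Qed.

Lemma bdYLam_rank1 u : bdYLam (proj u) ->
  exists (r : R) v, [/\ r != 0, Lam = -1 -> 0 < r & u = r%:CL *: rank1 v].
Proof.
case=> v _ /projP[r r0 ->].
have [LamE|LamN] := eqVneq Lam (-1); last first.
  by exists r, v; split=> // /eqP; rewrite (negPf LamN).
have [rneg|rpos] := ltP r 0; last by exists r, v; rewrite lt_def r0 rpos.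
exists (- r), (ell *: v); split; [by rewrite oppr_eq0 | by rewrite oppr_gt0 |].
have rE : r = - r * nrm (@ell R Lam) by rewrite nrmE /= LamE; ring.
by rewrite rank1Z scalerA -rmorphM -rE.
Qed.

(** For [Lam = -1] the positive factors [r] and [s] cancel from the determinant. For [Lam >= 0] the
    norm is nonnegative, and a positive determinant excludes zero whatever the signs of [r] and
    [s]. *)
Lemma br_nrm_gt0 (r s : R) v w : [\/ Lam = -1, Lam = 0 | Lam = 1] ->
    (Lam = -1 -> 0 < r) -> (Lam = -1 -> 0 < s) ->
    YLam (proj (r%:CL *: rank1 v + s%:CL *: rank1 w)) ->
  0 < nrm (br v w).
Proof.
move=> LamP r0 s0 /YLam_proj; rewrite det_rank1D /= => rs0.
have [LamE|Lam_ge0] : Lam = -1 \/ 0 <= Lam.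
  by case: LamP => ->; [left | right | right; exact: ler01].
  by move: rs0; rewrite pmulr_rgt0 // mulr_gt0 ?r0 ?s0.
rewrite lt_def nrm_ge0 // andbT; apply: contraTneq rs0 => ->.
by rewrite mulr0 ltxx.
Qed.

Lemma act_rank1 B (r : R) v w z : r != 0 -> z \is a GRing.unit ->
  B *m v = z *: w -> act (pgl_class B) (proj (r%:CL *: rank1 v)) = proj (rank1 w).
Proof.
move=> r0 zU Bv; rewrite act_proj -scalemxAr -scalemxAl projZ //.
by rewrite conj_rank1 Bv rank1Z projZ // -cl_unitE.
Qed.

(* the matrix carrying v1, v2, v3 to multiples of (1,0), (0,1), (1,1) *)
Definition frame_mx v1 v2 v3 : M :=
  mx2 (br v1 v3 * v2 1 0) (- (br v1 v3 * v2 0 0))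
      (- (br v3 v2 * v1 1 0)) (br v3 v2 * v1 0 0).

(** The two coordinates are the linear forms [br v v2] and [br v1 v], vanishing at [v2] and [v1],
    with weights that make them agree at [v3]. *)
Lemma frame_mxE v1 v2 v3 v :
  frame_mx v1 v2 v3 *m v = cv2 (br v1 v3 * br v v2) (br v3 v2 * br v1 v).
Proof.
apply/matrixP => i j; rewrite ord1 mxE sum_ord2 !mxE /br; move: i.
by apply: ord2P => /=; ring.
Qed.

Lemma det_frame_mx v1 v2 v3 :
  \det (frame_mx v1 v2 v3) = br v1 v3 * br v3 v2 * br v1 v2.
Proof. by rewrite det_mx22 !mxE /= /br; ring. Qed.

Lemma plucker v1 v2 v3 v4 :
  br v1 v3 * br v4 v2 - br v3 v2 * br v1 v4 = - (br v1 v2 * br v3 v4).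
Proof. by rewrite /br; ring. Qed.

Lemma nrmN z : nrm (- z) = nrm z.
Proof. by rewrite !nrmE /= !sqrrN. Qed.

Lemma nrmV_gt0 z : 0 < nrm z -> 0 < nrm z^-1.
Proof.
move=> z0; rewrite -(pmulr_rgt0 _ z0) -nrmM divrr ?nrm_gt0_unit //.
by rewrite nrmE /= expr0n mulr0 addr0 expr1n.
Qed.

(** The first two points kill the off-diagonal entries; the third equates the diagonal ones. *)
Lemma fixes_frame_scalar (D : M) :
    (exists2 r : R, r != 0 & rank1 (D *m cv2 1 0) = r%:CL *: rank1 (cv2 1 0)) ->
    (exists2 r : R, r != 0 & rank1 (D *m cv2 0 1) = r%:CL *: rank1 (cv2 0 1)) ->
    (exists2 r : R, r != 0 & rank1 (D *m cv2 1 1) = r%:CL *: rank1 (cv2 1 1)) ->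
  exists2 z, z \is a GRing.unit & D = z%:M.
Proof.
have entry w (r : R) i j : rank1 (D *m w) = r%:CL *: rank1 w ->
    (D i 0 * w 0 0 + D i 1 * w 1 0) * clconj (D j 0 * w 0 0 + D j 1 * w 1 0) =
    r%:CL * (w i 0 * clconj (w j 0)).
  by move=> /matrixP/(_ i j); rewrite [X in _ = X]mxE !rank1E !mxE !sum_ord2.
(* The algebra may have zero divisors, so a factor is cancelled only once it is known to be a
   unit. *)
have unitC z (x : C) : z * clconj x = 0 -> z \is a GRing.unit -> x = 0.
  move=> zx zU; rewrite -[x]clconjK -[clconj x](mulKr zU) zx mulr0.
  exact: rmorph0.
have nrmU z (r : R) : r != 0 -> z * clconj z = r%:CL -> z \is a GRing.unit.
  by move=> r0 zz; rewrite cl_unitE /normsq zz.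
move=> [r r0 /entry h1] [s s0 /entry h2] [t t0 /entry h3].
have := h1 0 0; have := h1 0 1; have := h2 1 1; have := h2 1 0; have := h3 0 1.
have := h3 1 1.
rewrite !mxE /= !(rmorph0, rmorph1, mulr0, mulr1, addr0, add0r).
move=> e11 e01 f10 f11 g01 g00.
have aU := nrmU _ _ r0 g00; have dU := nrmU _ _ s0 f11.
have c0 := unitC _ _ g01 aU; have b0 := unitC _ _ f10 dU.
rewrite c0 b0 addr0 add0r in e11 e01.
have ad : D 0 0 = D 1 1.
  have U : clconj (D 1 1) \is a GRing.unit.
    by apply: (nrmU _ t) => //; rewrite clconjK mulrC.
  by apply: (mulIr U); rewrite e01 e11.
exists (D 0 0) => //.
by apply: mx22P; rewrite ?mxE //= ?mulr1n ?mulr0n.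
Qed.

(** [D *m invmx B] fixes the three model points, hence is a unit scalar, which disappears in the
    quotient. *)
Lemma frame_unique (B D : M) u1 u2 u3 :
    \det B \is a GRing.unit ->
    act (pgl_class B) (proj u1) = proj (rank1 (cv2 1 0)) ->
    act (pgl_class B) (proj u2) = proj (rank1 (cv2 0 1)) ->
    act (pgl_class B) (proj u3) = proj (rank1 (cv2 1 1)) ->
    act (pgl_class D) (proj u1) = proj (rank1 (cv2 1 0)) ->
    act (pgl_class D) (proj u2) = proj (rank1 (cv2 0 1)) ->
    act (pgl_class D) (proj u3) = proj (rank1 (cv2 1 1)) ->
  pgl_class D = pgl_class B.
Proof.
move=> BU; have {}BU : B \in unitmx by rewrite unitmxE.
have step u w : act (pgl_class B) (proj u) = proj (rank1 w) ->
    act (pgl_class D) (proj u) = proj (rank1 w) ->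
    exists2 r : R, r != 0 & rank1 (D *m invmx B *m w) = r%:CL *: rank1 w.
  rewrite !act_proj => /projP[r r0 Bu] /esym/projP[s s0 Du].
  exists (r * s); first exact: mulf_neq0.
  rewrite -conj_rank1 [in LHS]Bu !ctrM -scalemxAr -scalemxAl rmorphM -scalerA; congr (_ *: _).
  rewrite -Du !mulmxA mulmxKV // -!mulmxA; congr (_ *m (_ *m _)).
  by rewrite mulmxA -ctrM mulVmx // /ctr trmx1 map_mx1 mul1mx.
move=> hB1 hB2 hB3 hD1 hD2 hD3.
have [z zU Dz] := fixes_frame_scalar (step _ _ hB1 hD1) (step _ _ hB2 hD2) (step _ _ hB3 hD3).
have {Dz} -> : D = z *: B.
  by rewrite -[LHS](mulmxKV BU) Dz mul_scalar_mx.
apply/seteqP; split=> [_ [t /= tU <-]|_ [t /= tU <-]].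
  by exists (t * z); rewrite ?scalerA //= unitrM tU.
by exists (t / z); rewrite /= ?unitrM ?unitrV ?tU // scalerA divrK.
Qed.

End Hermitian.

(** * Edges of the cone and nondegeneracy of the four vertices *)

Section Tetrahedron.
Variables (R : realType) (Lam : R).
Local Notation C := (clam Lam).
Local Notation M := 'M[C]_2.

(** The sum of two generators has two nonzero coordinates in a free family, so it lies on no vertex
    ray and the convexity hypothesis applies to it. *)
Lemma cone_edge (u : 'I_4 -> M) i j : rfree u -> i != j ->
  (forall w, cone u w -> (forall k, ~ vertex_ray u k w) -> YLam (proj w)) ->
  YLam (proj (u i + u j)).
Proof.
move=> uf ij; pose b k : R := (k == i)%:R + (k == j)%:R.
have pick k : \sum_l ((l == k)%:R : R)%:CL *: u l = u k.
  rewrite (bigD1 k) //= eqxx rmorph1 scale1r big1 ?addr0 // => l /negPf ->.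
  by rewrite rmorph0 scale0r.
have be : rcomb u b = u i + u j.
  rewrite -(pick i) -(pick j) -big_split; apply: eq_bigr => k _ /=.
  by rewrite rmorphD scalerDl.
apply; first exists b => //=.
  split=> [k|]; first by rewrite addr_ge0.
  rewrite psumr_neq0 => [|k _]; last by rewrite addr_ge0.
  by apply/hasP; exists i; rewrite ?mem_index_enum //= /b eqxx ltr_pwDl.
move=> k [c /= c0 e].
have /uf f0 : rcomb u (fun l => b l - c * (l == k)%:R) = 0.
  transitivity (rcomb u b - c%:CL *: u k); last by rewrite be e subrr.
  rewrite -(pick k) scaler_sumr -sumrB; apply: eq_bigr => l _.
  by rewrite rmorphB rmorphM scalerBl scalerA.
have := f0 i; have := f0 j; rewrite /b !eqxx [j == i]eq_sym (negPf ij) !add0r addr0.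
have [<-|ki] := eqVneq i k; last first.
  by move=> _ /eqP; rewrite mulr0 subr0 oner_eq0.
by rewrite [j == i]eq_sym (negPf ij) mulr0 subr0 => /eqP; rewrite oner_eq0.
Qed.

Lemma sum_ord4 (V : nmodType) (F : 'I_4 -> V) : \sum_i F i = F 0 + F 1 + F 2 + F 3.
Proof.
rewrite !big_ord_recl big_ord0 addr0 !addrA.
by congr (_ + F _ + F _ + F _); apply: val_inj.
Qed.

Lemma rcomb4 (u : 'I_4 -> M) (b : 'I_4 -> R) :
  rcomb u b = (b 0)%:CL *: u 0 + (b 1)%:CL *: u 1 + (b 2)%:CL *: u 2 + (b 3)%:CL *: u 3.
Proof. exact: sum_ord4. Qed.

End Tetrahedron.

(** Four real symmetric 2 by 2 matrices are dependent, as their space has dimension three. With 1 on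
    the last matrix, the off-diagonal entry forces [- x] and the diagonal entries give the rest. *)
Lemma rank1_real_dependence (R : realType) (Lam x : R) :
  (x - x ^+ 2)%:CL *: rank1 (cv2 1 0) + (x - 1)%:CL *: rank1 (cv2 0 1) +
  (- x)%:CL *: rank1 (cv2 1 1) + rank1 (cv2 x%:CL 1) = 0 :> 'M[clam Lam]_2.
Proof.
have cx : clconj x%:CL = x%:CL :> clam Lam by rewrite /clconj /= oppr0.
rewrite !rank1_cv2 /normsq cx !(rmorph0, rmorph1, rmorphB, rmorphN, rmorphXn) /=.
by apply: mx22P; rewrite !mxE /=; ring.
Qed.

Lemma frame_nondegenerate (R : realType) (Lam : R) (u : 'I_4 -> 'M[clam Lam]_2)
    (r : 'I_4 -> R) (v : 'I_4 -> 'cV[clam Lam]_2) (B : 'M[clam Lam]_2)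
    (k1 k2 k3 k4 z : clam Lam) :
    rfree u -> (forall i, r i != 0) ->
    (forall i, u i = (r i)%:CL *: rank1 (v i)) -> \det B \is a GRing.unit ->
    0 < nrm k1 -> 0 < nrm k2 -> 0 < nrm k3 -> 0 < nrm k4 ->
    B *m v 0 = k1 *: cv2 1 0 -> B *m v 1 = k2 *: cv2 0 1 ->
    B *m v 2 = k3 *: cv2 1 1 -> B *m v 3 = k4 *: cv2 z 1 ->
  clim z != 0.
Proof.
move=> uf r0 uE BU k10 k20 k30 k40 B1 B2 B3 B4; apply/eqP => z0.
have {z0} zE : z = (clre z)%:CL by apply: clamP.
move: (clre z) zE => x zE.
have conjE i k w : B *m v i = k *: w ->
    B *m u i *m ctr B = (r i * nrm k)%:CL *: rank1 w.
  move=> Bv; rewrite uE -scalemxAr -scalemxAl conj_rank1 Bv rank1Z.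
  by rewrite scalerA rmorphM.
(* Conjugation by [B] turns [u i] into the model matrix times [r i * nrm k], so the coefficients of
   the model dependence are divided by these factors. *)
have [b [b0 b1 b2 b3]] : exists b : 'I_4 -> R,
    [/\ b 0 * (r 0 * nrm k1) = x - x ^+ 2, b 1 * (r 1 * nrm k2) = x - 1,
        b 2 * (r 2 * nrm k3) = - x & b 3 * (r 3 * nrm k4) = 1].
  exists (tnth [tuple (x - x ^+ 2) / (r 0 * nrm k1); (x - 1) / (r 1 * nrm k2);
                      - x / (r 2 * nrm k3); 1 / (r 3 * nrm k4)]).
  by split; rewrite divfK // mulf_neq0 ?r0 ?gt_eqF.
have termE i k w : B *m v i = k *: w ->
    B *m ((b i)%:CL *: u i) *m ctr B = (b i * (r i * nrm k))%:CL *: rank1 w.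
  by move=> Bv; rewrite -scalemxAr -scalemxAl (conjE _ _ _ Bv) scalerA -rmorphM.
have conj0 : B *m rcomb u b *m ctr B = 0.
  rewrite rcomb4 !mulmxDr !mulmxDl (termE 0 _ _ B1) (termE 1 _ _ B2).
  rewrite (termE 2 _ _ B3) (termE 3 _ _ B4) b0 b1 b2 b3 zE rmorph1 scale1r.
  exact: rank1_real_dependence.
have /uf f0 : rcomb u b = 0.
  have BU' : B \in unitmx by rewrite unitmxE.
  have cBU : ctr B *m ctr (invmx B) = 1%:M.
    by rewrite -ctrM mulVmx // /ctr trmx1 map_mx1.
  rewrite -[LHS](mulKmx BU') -[B *m _]mulmx1 -cBU mulmxA conj0.
  by rewrite mul0mx mulmx0.
by move/eqP: b3; rewrite f0 mul0r eq_sym oner_eq0.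
Qed.

Theorem proposition4p13 (R : realType) (Lam : R) (I : set (ppoint Lam))
    (y1 y2 y3 y4 : ppoint Lam) :
  [\/ Lam = -1, Lam = 0 | Lam = 1] ->
  ideal_tetrahedron I (tnth [tuple y1; y2; y3; y4]) ->
  exists (B : pgl Lam) (a b c : R),
    [/\ normalizes y1 y2 y3 y4 B a b c,
        (Lam = 1 -> [/\ 0 < `|a| < pi, 0 < `|b| < pi & 0 < `|c| < pi]) &
        forall (B' : pgl Lam) (a' b' c' : R),
          normalizes y1 y2 y3 y4 B' a' b' c' -> B' = B].
Proof.
move=> LamP [u [[_ uf] cone_u _ yE _]].
have /choice [rv rvP] i : exists p : R * 'cV[clam Lam]_2,
    [/\ p.1 != 0, Lam = -1 -> 0 < p.1 & u i = p.1%:CL *: rank1 p.2].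
  have [yi yib] := yE i; rewrite yi in yib.
  by have [r [v h]] := bdYLam_rank1 yib; exists (r, v).
pose r i := (rv i).1; pose v i := (rv i).2.
have r0 i : r i != 0 by have [] := rvP i.
have uE i : u i = (r i)%:CL *: rank1 (v i) by have [] := rvP i.
have brv i j : i != j -> 0 < nrm (br (v i) (v j)).
  move=> ij; have [_ ri _] := rvP i; have [_ rj _] := rvP j.
  by apply: (br_nrm_gt0 LamP ri rj); rewrite -!uE; exact: cone_edge.
have y1E : y1 = proj (u 0) by have [] := yE 0.
have y2E : y2 = proj (u 1) by have [] := yE 1.
have y3E : y3 = proj (u 2) by have [] := yE 2.
have y4E : y4 = proj (u 3) by have [] := yE 3.
pose B := frame_mx (v 0) (v 1) (v 2).
pose k4 := br (v 2) (v 1) * br (v 0) (v 3).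
(* The ratio of the two coordinates of [B *m v 3]: a cross-ratio of the four vertices. *)
pose z := br (v 0) (v 2) * br (v 3) (v 1) / k4.
have k40 : 0 < nrm k4 by rewrite nrmM mulr_gt0 ?brv.
have k4U := nrm_gt0_unit k40.
have detB : 0 < nrm (\det B) by rewrite det_frame_mx !nrmM !mulr_gt0 ?brv.
have BU := nrm_gt0_unit detB.
have B1 : B *m v 0 = (br (v 0) (v 2) * br (v 0) (v 1)) *: cv2 1 0.
  rewrite frame_mxE; apply/matrixP => i j; rewrite !mxE; move: i.
  by apply: ord2P; rewrite /= /br; ring.
have B2 : B *m v 1 = (br (v 2) (v 1) * br (v 0) (v 1)) *: cv2 0 1.
  rewrite frame_mxE; apply/matrixP => i j; rewrite !mxE; move: i.
  by apply: ord2P; rewrite /= /br; ring.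
have B3 : B *m v 2 = (br (v 0) (v 2) * br (v 2) (v 1)) *: cv2 1 1.
  rewrite frame_mxE; apply/matrixP => i j; rewrite !mxE; move: i.
  by apply: ord2P; rewrite /= /br; ring.
have B4 : B *m v 3 = k4 *: cv2 z 1.
  rewrite frame_mxE; apply/matrixP => i j; rewrite !mxE; move: i.
  by apply: ord2P; [rewrite /z mulrCA divrr ?mulr1 | rewrite mulr1].
have k10 : 0 < nrm (br (v 0) (v 2) * br (v 0) (v 1)).
  by rewrite nrmM mulr_gt0 ?brv.
have k20 : 0 < nrm (br (v 2) (v 1) * br (v 0) (v 1)).
  by rewrite nrmM mulr_gt0 ?brv.
have k30 : 0 < nrm (br (v 0) (v 2) * br (v 2) (v 1)).
  by rewrite nrmM mulr_gt0 ?brv.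
have z0 : 0 < nrm z by rewrite !nrmM !mulr_gt0 ?brv ?nrmV_gt0.
have z1 : 0 < nrm (z - 1).
  have -> : z - 1 = - (br (v 0) (v 1) * br (v 2) (v 3)) / k4.
    by rewrite -plucker mulrBl divrr.
  by rewrite nrmM nrmN nrmM !mulr_gt0 ?brv ?nrmV_gt0.
have zim := frame_nondegenerate uf r0 uE BU k10 k20 k30 k40 B1 B2 B3 B4.
have [a [b [c [abc sa bounds zE]]]] := exists_angles LamP z0 z1 zim.
have e1 : mx2 1 0 0 0 = rank1 (cv2 1 0) :> 'M[clam Lam]_2.
  by rewrite rank1_cv2 /normsq !rmorph1 !rmorph0 !mulr0 mul0r mulr1.
have e2 : mx2 0 0 0 1 = rank1 (cv2 0 1) :> 'M[clam Lam]_2.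
  by rewrite rank1_cv2 /normsq !rmorph1 !rmorph0 !mulr0 mul0r mulr1.
have e3 : mx2 1 1 1 1 = rank1 (cv2 1 1) :> 'M[clam Lam]_2.
  by rewrite rank1_cv2 /normsq !rmorph1 mulr1.
exists (pgl_class B), a, b, c; split=> //.
  split=> //; first by exists B; rewrite //=; apply/cl_pos_normsq.
  rewrite e1 e2 e3 y1E y2E y3E y4E !uE; split.
  - exact: (act_rank1 _ (nrm_gt0_unit k10)).
  - exact: (act_rank1 _ (nrm_gt0_unit k20)).
  - exact: (act_rank1 _ (nrm_gt0_unit k30)).
  (* The normal form is the rank-one matrix of [(z, 1)]: its corner [nrm z] is the squared ratio
     because [exp_ell] has norm 1, and conjugating [z] negates [c]. *)
  rewrite (act_rank1 (r0 3) k4U B4) rank1_cv2; congr (proj (mx2 _ _ _ _)).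
  - rewrite normsq_nrm zE nrmN nrmM nrm_exp_ell // mulr1 nrmE /=.
    by rewrite expr0n mulr0 addr0 expr_div_n.
  - by rewrite rmorph1 mulr1.
  - by rewrite mul1r zE exp_ellN // rmorphN /= clconj_ofRM.
  - by rewrite /normsq rmorph1 mulr1.
(* A competitor sends the first three vertices to the same frame as [B], which determines its
   class. *)
move=> B' a' b' c' [[D /cl_pos_normsq D0 <-] _ _ [D1 D2 D3 _]].
rewrite e1 e2 e3 y1E y2E y3E in D1 D2 D3.
apply: (frame_unique BU _ _ _ D1 D2 D3); rewrite uE.
- exact: (act_rank1 _ (nrm_gt0_unit k10)).
- exact: (act_rank1 _ (nrm_gt0_unit k20)).
- exact: (act_rank1 _ (nrm_gt0_unit k30)).
Qed.
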